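(* The spaces $\mathrm{R}^{\rightarrow}+1$ and ${}^{\leftarrow}\mathrm{I}^{\rightarrow}$ are Valdivia compact.
   Context: A compact space $X$ is Valdivia compact if for some $\kappa$ there is an embedding $X\subseteq[0,1]^\kappa$ such that $X=\operatorname{cl}(X\cap\Sigma(\kappa))$, where $\Sigma(\kappa)=\{x\in[0,1]^\kappa: |\{\alpha<\kappa: x(\alpha)\neq 0\}|\le\aleph_0\}$. Linearly ordered sets carry the order topology; $X+1$ is $X$ with a new greatest element added; $X^{-1}$ is $X$ with the reversed order. The long ray $\mathrm{R}^{\rightarrow}$ is the set $\omega_1\times[0,1)$ ordered by $(\alpha,s)<(\beta,t)$ iff $\alpha<\beta$, or $\alpha=\beta$ and $s<t$ (that is, $\omega_1$ consecutive copies of $[0,1)$). The long interval ${}^{\leftarrow}\mathrm{I}^{\rightarrow}$ is the unique (up to order isomorphism) linearly ordered space $[a,b]$, with least element $a$ and greatest element $b$, such that for every $p\in(a,b)$ the interval $[p,b]$ is order isomorphic to $\mathrm{R}^{\rightarrow}+1$ and the interval $[a,p]$ is order isomorphic to $(\mathrm{R}^{\rightarrow}+1)^{-1}$. *)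

(* Defs.v *)
From HB Require Import structures.
From mathcomp Require Import all_boot all_order all_algebra.
From mathcomp Require Import all_classical all_reals all_analysis.
From mathcomp Require wochoice.
Import numFieldNormedType.Exports.
Import Order.TTheory GRing.Theory Num.Theory.

Set Implicit Arguments.
Unset Strict Implicit.
Unset Printing Implicit Defensive.

Local Open Scope classical_set_scope.
Local Open Scope ring_scope.

(* The ordinal omega_1 is realized as an initial segment of a fixed well-order
   of the uncountable set of all subsets of nat: it consists of the points with
   countably many predecessors. The lemmas [omega1_well_founded],
   [omega1_uncountable] and [omega1_segment_countable] determine it up to
   isomorphism. *)

Definition wo_le : rel (set nat) :=
  projT1 (wochoice.well_ordering_principle (set nat)).

Lemma wo_le_min (A : set (set nat)) :
  A !=set0 -> exists2 z, A z & forall x, A x -> wo_le z x.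
Proof.
move=> [x Ax]; have := projT2 (wochoice.well_ordering_principle (set nat)).
move=> /(_ [pred y | `[< A y >]]) []; first by exists x; exact/asboolP.
by move=> z [[/asboolP Az minz] _]; exists z => // y Ay; apply/minz/asboolP.
Qed.

Lemma wo_le_total : total wo_le.
Proof.
move=> x y; have [|z [] -> /= minz] := @wo_le_min [set x; y].
- by exists x; left.
- by rewrite minz//; right.
- by rewrite orbC minz//; left.
Qed.

Lemma wo_le_refl : reflexive wo_le.
Proof. by move=> x; have := wo_le_total x x; rewrite orbb. Qed.

Lemma wo_le_anti : antisymmetric wo_le.
Proof.
move=> x y /andP[xy yx].
have := projT2 (wochoice.well_ordering_principle (set nat)).
move=> /(_ [pred z | (z == x) || (z == y)]) [].
  by exists x; rewrite inE eqxx.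
move=> z [_ uz].
have <- : z = x.
  apply: uz; split; first by rewrite inE eqxx.
  by move=> t; rewrite inE => /orP[] /eqP -> //; exact: wo_le_refl.
apply: uz; split; first by rewrite inE eqxx orbT.
by move=> t; rewrite inE => /orP[] /eqP -> //; exact: wo_le_refl.
Qed.

Lemma wo_le_trans : transitive wo_le.
Proof.
move=> y x z xy yz.
have [|m mm minm] := @wo_le_min [set t | [\/ t = x, t = y | t = z]].
  by exists x; constructor 1.
have mx : wo_le m x by apply: minm; constructor 1.
have my : wo_le m y by apply: minm; constructor 2.
have mz : wo_le m z by apply: minm; constructor 3.
case: mm => e; rewrite e in mx my mz => //.
- by have -> : x = y by apply: wo_le_anti; rewrite xy.
- by have <- : y = z by apply: wo_le_anti; rewrite yz.
Qed.

Definition wo_pred (x : set nat) : set (set nat) :=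
  [set y | y != x /\ wo_le y x].

Record omega1 := Omega1 {
  omega1_val :> set nat;
  omega1_valP : `[< countable (wo_pred omega1_val) >] }.

HB.instance Definition _ := [isSub for omega1_val].
HB.instance Definition _ := [Choice of omega1 by <:].

Fact omega1_display : Order.disp_t. Proof. exact: Order.Disp tt tt. Qed.

Definition omega1_le (x y : omega1) : bool :=
  wo_le (omega1_val x) (omega1_val y).

Lemma omega1_le_refl : reflexive omega1_le.
Proof. by move=> x; exact: wo_le_refl. Qed.

Lemma omega1_le_anti : antisymmetric omega1_le.
Proof. by move=> x y /wo_le_anti xy; exact: val_inj. Qed.

Lemma omega1_le_trans : transitive omega1_le.
Proof. by move=> y x z; exact: wo_le_trans. Qed.

Lemma omega1_le_total : total omega1_le.
Proof. by move=> x y; exact: wo_le_total. Qed.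

HB.instance Definition _ := Order.Le_isPOrder.Build omega1_display omega1
  omega1_le_refl omega1_le_anti omega1_le_trans.
HB.instance Definition _ :=
  Order.POrder_isTotal.Build omega1_display omega1 omega1_le_total.

Lemma omega1_well_founded (A : set omega1) :
  A !=set0 -> exists2 z, A z & forall x, A x -> (z <= x)%O.
Proof.
move=> [x Ax]; have [|_ [z Az <-] minz] := @wo_le_min (omega1_val @` A).
  by exists (omega1_val x), x.
by exists z => // y Ay; apply: minz; exists y.
Qed.

Lemma omega1_segment_countable (x : omega1) : countable [set y | (y < x)%O].
Proof.
have /asboolP/countable_injP[f finj] := omega1_valP x.
apply/countable_injP; exists (f \o omega1_val) => y z.
rewrite !inE /= => yx zx fyz; apply: val_inj; apply: finj => //; rewrite inE.
- by move: yx; rewrite lt_neqAle => /andP[/eqP yx ?]; split => //;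
    apply/eqP => /val_inj.
- by move: zx; rewrite lt_neqAle => /andP[/eqP zx ?]; split => //;
    apply/eqP => /val_inj.
Qed.

Lemma omega1_uncountable : ~ countable [set: omega1].
Proof.
move=> cW; have cV : countable (range omega1_val).
  exact: sub_countable (card_image_le _ _) cW.
have [all_seg|/existsNP[x0 x0P]] := pselect (forall x, countable (wo_pred x)).
  have /countable_injP[f finj] : countable [set: set nat].
    apply: sub_countable cV; apply: subset_card_le => x _.
    by exists (Omega1 (asboolT (all_seg x))).
  pose D := [set n | exists2 A : set nat, f A = n & ~ A n].
  have DfD : ~ D (f D).
    move=> Df; have [A fA nA] := Df; apply: (nA).
    by have -> : A = D by apply: finj; rewrite ?inE.
  by apply: (DfD); exists D.
have [|z zP minz] := @wo_le_min [set x | ~ countable (wo_pred x)].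
  by exists x0.
apply: zP; apply: sub_countable cV; apply: subset_card_le => y [yz lyz].
have [cy|ncy] := pselect (countable (wo_pred y)).
  by exists (Omega1 (asboolT cy)).
by case/eqP: yz; apply: wo_le_anti; rewrite lyz minz.
Qed.

Record ico01 (R : realType) := Ico01 {
  ico01_val :> R;
  ico01_valP : 0 <= ico01_val < 1 }.

HB.instance Definition _ (R : realType) := [isSub for @ico01_val R].
HB.instance Definition _ (R : realType) := [Choice of ico01 R by <:].
HB.instance Definition _ (R : realType) :=
  [SubChoice_isSubOrder of ico01 R by <: with ring_display].

Definition long_ray (R : realType) : Type := omega1 *l ico01 R.

HB.instance Definition _ (R : realType) := Order.Total.on (long_ray R).

Inductive add_top (T : Type) : Type := Below of T | Top.
Arguments Top {T}.

Definition add_top_option T (x : add_top T) : option T :=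
  if x is Below t then Some t else None.
Definition option_add_top T (x : option T) : add_top T :=
  if x is Some t then Below t else Top.

Lemma add_top_optionK T : cancel (@add_top_option T) (@option_add_top T).
Proof. by case. Qed.

HB.instance Definition _ (T : choiceType) :=
  Choice.copy (add_top T) (can_type (@add_top_optionK T)).

Section AddTopOrder.
Context {d : Order.disp_t} {T : orderType d}.

Definition add_top_le (x y : add_top T) : bool :=
  match x, y with
  | _, Top => true
  | Top, Below _ => false
  | Below s, Below t => (s <= t)%O
  end.

Lemma add_top_le_refl : reflexive add_top_le.
Proof. by case=> [t|] /=. Qed.

Lemma add_top_le_anti : antisymmetric add_top_le.
Proof. by case=> [s|] [t|] //= /le_anti ->. Qed.

Lemma add_top_le_trans : transitive add_top_le.
Proof. by case=> [s|] [t|] [u|] //=; exact: le_trans. Qed.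

Lemma add_top_le_total : total add_top_le.
Proof. by case=> [s|] [t|] //=; exact: le_total. Qed.

HB.instance Definition _ := Order.Le_isPOrder.Build d (add_top T)
  add_top_le_refl add_top_le_anti add_top_le_trans.
HB.instance Definition _ :=
  Order.POrder_isTotal.Build d (add_top T) add_top_le_total.

End AddTopOrder.

Definition order_isomorphic_to d d' (L : orderType d) (A : set L)
    (M : orderType d') : Prop :=
  exists f : L -> M, set_bij A [set: M] f /\
    forall x y, A x -> A y -> (f x <= f y)%O = (x <= y)%O.

(* The interval ]\bot, \top[ is required to be nonempty: otherwise the condition
   on its points is void, and one- and two-point orders would qualify. *)
Definition is_long_interval (R : realType) d (L : tbOrderType d) : Prop :=
  (exists p : L, (\bot < p < \top)%O) /\
  forall p : L, (\bot < p < \top)%O ->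
    order_isomorphic_to `[p, \top%O] (add_top (long_ray R)) /\
    order_isomorphic_to `[\bot%O, p] (add_top (long_ray R))^d.

Definition cube (R : realType) (K : Type) : set {ptws K -> R} :=
  [set x | forall k, 0 <= x k <= 1].

Definition Sigma (R : realType) (K : Type) : set {ptws K -> R} :=
  [set x | cube x /\ countable [set k | x k != 0]].

Definition is_embedding (X Y : topologicalType) (f : X -> Y) : Prop :=
  injective f /\ @open X = @open (initial_topology f).

(* The closure is taken in R^K; as the cube is closed there, this is the same
   as the closure in the cube. *)
Definition valdivia_compact (R : realType) (X : topologicalType) : Prop :=
  compact [set: X] /\
  exists (K : Type) (f : X -> {ptws K -> R}),
    [/\ is_embedding f,
        range f `<=` @cube R K &
        range f = closure (range f `&` @Sigma R K)].

(* Main.v *)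
(* Order R->+1 as omega_1 blocks [0, 1) followed by a top point. The block
   coordinate of index a is 0 before block a, the identity on it and 1 after it;
   it is monotone onto [0, 1], hence continuous, and these coordinates separate
   points. A point other than the top has only countably many nonzero
   coordinates, and the top is a limit of such points. For the long interval
   with an interior point p, retract onto [p, b] and onto [a, p] and use the block
   coordinates of both halves, the second half being order-reversed: all
   coordinates vanish at p, and only a and b have uncountable support. *)
Require Import Defs.
From mathcomp Require Import all_boot all_order all_algebra.
From mathcomp Require Import all_classical all_reals all_analysis.
Import numFieldNormedType.Exports.
Import Order.TTheory GRing.Theory Num.Theory.

Set Implicit Arguments.
Unset Strict Implicit.
Unset Printing Implicit Defensive.

Local Open Scope classical_set_scope.
Local Open Scope ring_scope.

(** * Compactness and continuity in order topologies *)

(** An ultrafilter [F] converges to the supremum [c] of the points [x] whose ray [[x, +oo[] lies in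
    [F]. For [u] below [c] some such [x] exceeds [u], so the ray above [u] is in [F]; for [v] above
    [c] the ray from [v] is not in [F], so its complement is. *)
Lemma complete_order_compact d (T : orderTopologicalType d) :
  (forall A : set T, supremums A !=set0) -> compact [set: T].
Proof.
move=> supT; rewrite compact_ultra => F FU _.
have [c [ubc lubc]] := supT [set x | F `[x, +oo[%classic].
exists c; split=> // U.
rewrite itv_nbhsE => -[i [io ci] iU]; apply: (filterS iU).
have Fl u : (u < c)%O -> F `]u, +oo[%classic.
  move=> uc; have [v Fv uv] : exists2 v, F `[v, +oo[%classic & (u < v)%O.
    apply: contrapT => noV; have /lubc : ubound [set x | F `[x, +oo[%classic] u.
      by move=> v Fv; rewrite leNgt; apply/negP => uv; apply: noV; exists v.
    by rewrite leNgt uc.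
  by apply: filterS Fv => x /=; rewrite !in_itv/= !andbT; exact: lt_le_trans.
have Fr v : (c < v)%O -> F `]-oo, v[%classic.
  move=> cv; have [/ubc|] := in_ultra_setVsetC `[v, +oo[%classic FU.
    by rewrite leNgt cv.
  by rewrite setCitvr.
case: i {iU} ci io => [[[] l|[]] [[] r|[]]];
  rewrite /itv_open_ends //= in_itv /=.
- move=> /andP[lc cr] _; rewrite set_itv_splitI.
  by apply: filterI; [exact: Fl|exact: Fr].
- by rewrite andbT => ? _; exact: Fl.
- by move=> ? _; exact: Fr.
- by move=> _ _; rewrite set_itvE; exact: filterT.
Qed.

(* No jump can occur, as a jump would leave a gap in the range. *)
Lemma nondecreasing_itv_continuous (R : realType) d (T : orderTopologicalType d)
    (f : T -> R) :
  {homo f : x y / (x <= y)%O >-> x <= y} -> is_interval (range f) ->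
  continuous f.
Proof.
move=> fmono fitv x; apply/cvgrPdist_lt => e e0.
have fI z : range f z -> forall t, f x <= t <= z \/ z <= t <= f x -> range f t.
  by move=> fz t [] /fitv; apply => //; exists x.
have ltf y z : f y < f z -> (y < z)%O.
  by rewrite !ltNge; apply: contraNN => /fmono; rewrite leNgt => /negbTE ->.
have nl : \forall y \near x, f x - e < f y.
  have [[z zx]|nz] := pselect (exists z, f z < f x); last first.
    apply: nearW => y; apply: (@lt_le_trans _ _ (f x)).
      by rewrite ltrBlDr ltrDl.
    by rewrite leNgt; apply/negP => yx; apply: nz; exists y.
  (* This value is below [f x], above [f x - e] and not below [f z], so it is attained at some [w],
     and the open ray above [w] is the required neighbourhood. *)
  have [w _ fw] : range f (Num.max (f z) (f x - e / 2)).
    apply: (fI (f z)); first by exists z.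
    right; rewrite le_max lexx/= ge_max (ltW zx)/= lerBlDr lerDl.
    by rewrite ltW// divr_gt0.
  have wx : (w < x)%O.
    by apply: ltf; rewrite fw gt_max zx/= ltrBlDr ltrDl divr_gt0.
  near=> y; apply: (@lt_le_trans _ _ (f w)).
    rewrite fw lt_max; apply/orP; right.
    by rewrite ltrD2l ltrN2 ltr_pdivrMr// ltr_pMr// ltr1n.
  apply: fmono; have : `]w, +oo[%classic y.
    near: y; apply: open_nbhs_nbhs; split; first exact: rray_open.
    by rewrite /= in_itv/= wx.
  by rewrite /= in_itv/= andbT => /ltW.
have nr : \forall y \near x, f y < f x + e.
  have [[z zx]|nz] := pselect (exists z, f x < f z); last first.
    apply: nearW => y; apply: (@le_lt_trans _ _ (f x)).
      by rewrite leNgt; apply/negP => yx; apply: nz; exists y.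
    by rewrite ltrDl.
  have [w _ fw] : range f (Num.min (f z) (f x + e / 2)).
    apply: (fI (f z)); first by exists z.
    by left; rewrite ge_min lexx/= le_min (ltW zx)/= lerDl ltW// divr_gt0.
  have wx : (x < w)%O.
    by apply: ltf; rewrite fw lt_min zx/= ltrDl divr_gt0.
  near=> y; apply: (@le_lt_trans _ _ (f w)).
    apply: fmono; have : `]-oo, w[%classic y.
      near: y; apply: open_nbhs_nbhs; split; first exact: lray_open.
      by rewrite /= in_itv/= wx.
    by rewrite /= in_itv/= => /ltW.
  rewrite fw gt_min; apply/orP; right.
  by rewrite ltrD2l ltr_pdivrMr// ltr_pMr// ltr1n.
near=> y; rewrite ltr_distlC; apply/andP; split.
  by near: y.
by near: y.
Unshelve. all: by end_near. Qed.

Lemma nonincreasing_itv_continuous (R : realType) d (T : orderTopologicalType d)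
    (f : T -> R) :
  {homo f : x y / (x <= y)%O >-> y <= x} -> is_interval (range f) ->
  continuous f.
Proof.
move=> fmono fitv; have Nfc : continuous (fun x => - f x).
  apply: nondecreasing_itv_continuous => [x y /fmono|]; first by rewrite lerN2.
  move=> _ _ [x _ <-] [y _ <-] z; rewrite lerNl lerNr andbC => zxy.
  have [t _ tz] : range f (- z).
    by apply: (fitv _ _ _ _ _ zxy); [exists y|exists x].
  by exists t => //; rewrite tz opprK.
have -> : f = (fun x => - - f x) by apply/funext => x; rewrite opprK.
by move=> x; apply: cvgN; exact: Nfc.
Qed.

(** * A density criterion for Valdivia compactness *)

Lemma continuous_ptws (R : realType) (T : topologicalType) (K : choiceType)
    (f : T -> {ptws K -> R}) :
  (forall k, continuous (fun x => f x k)) -> continuous f.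
Proof.
move=> fc x; apply/cvg_sup => k; apply/cvg_image => //.
  by rewrite predeqE => t; split=> // _; exists (fun=> t).
move=> U /fc; rewrite !nbhs_simpl/= => fU.
exists ((fun g : {ptws K -> R} => g k) @^-1` U).
  exact: fU.
by rewrite image_preimage// predeqE => t; split=> // _; exists (fun=> t).
Qed.

(** A continuous injection of a compact space into a Hausdorff one is closed, hence an embedding
    with closed range. By continuity, density of the countably supported points passes to the
    range. *)
Lemma valdivia_dense (R : realType) (X : topologicalType) (K : choiceType)
    (f : X -> {ptws K -> R}) :
  compact [set: X] -> injective f -> (forall k, continuous (fun x => f x k)) ->
  (forall x k, 0 <= f x k <= 1) ->
  dense [set x | countable [set k | f x k != 0]] -> valdivia_compact R X.
Proof.
move=> Xc finj fkc f01 Dd; have fc := continuous_ptws fkc.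
have Yh : hausdorff_space {ptws K -> R}.
  by apply: hausdorff_product => k; exact: Rhausdorff.
have fclosed (C : set X) : closed C -> closed (f @` C).
  move=> Cc; apply: compact_closed => //; apply: continuous_compact.
    exact: continuous_subspaceT.
  by apply: subclosed_compact Cc Xc _.
split=> //; exists K, f; split.
- split=> //; rewrite predeqE => U; split=> [Uo|[V Vo <-]]; last first.
    by apply: open_comp => // x _; exact: fc.
  exists (~` (f @` ~` U)).
    by rewrite openC; apply: fclosed; rewrite closedC.
  rewrite predeqE => x; split=> /=.
    by move=> nfx; apply: contrapT => nUx; apply: nfx; exists x.
  by move=> Ux [y nUy /finj yx]; apply: nUy; rewrite yx.
- by move=> _ [x _ <-] k.
rewrite eqEsubset; split=> [_ [x _ <-] U fxU|].
  have : nbhs x (f @^-1` U) by exact: fc.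
  rewrite nbhsE => -[V [Vo Vx] VU].
  have [y [/VU Uy Dy]] := Dd _ (ex_intro _ x Vx) Vo.
  by exists (f y); split=> //; split; [exists y|split=> // k].
rewrite [X in _ `<=` X](iffLR (closure_id _)); last exact: fclosed closedT.
by apply: closure_subset => y [].
Qed.

(** * Block coordinates on the long ray with a top *)

Definition block_coord (R : realType) (a : omega1) (x : add_top (long_ray R)) :
    R :=
  if x is Below t then
    if (a < t.1)%O then 1 else if a == t.1 then ico01_val t.2 else 0
  else 1.

Lemma ico01_ge0 (R : realType) (t : ico01 R) : 0 <= ico01_val t.
Proof. by have /andP[] := ico01_valP t. Qed.

Lemma ico01_lt1 (R : realType) (t : ico01 R) : ico01_val t < 1.
Proof. by have /andP[] := ico01_valP t. Qed.

Lemma block_coord_itv (R : realType) a (x : add_top (long_ray R)) :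
  0 <= block_coord a x <= 1.
Proof.
case: x => [t|] /=; last by rewrite ler01 lexx.
case: ifP => _; first by rewrite ler01 lexx.
by case: ifP => _; rewrite ?lexx ?ler01// ico01_ge0 ltW// ico01_lt1.
Qed.

Lemma le_Below (R : realType) (s t : long_ray R) :
  (Below s <= Below t)%O =
  (s.1 < t.1)%O || (s.1 == t.1) && (ico01_val s.2 <= ico01_val t.2).
Proof.
rewrite [LHS](_ : _ = (s <= t)%O)//.
case: s t => [a s] [b t].
rewrite Order.ProdLexiOrder.leEprodlexi /=.
by case: (ltgtP a b).
Qed.

Lemma block_coord_homo (R : realType) a :
  {homo @block_coord R a : x y / (x <= y)%O >-> x <= y}.
Proof.
move=> [s|] [t|] // st; last first.
  by have /andP[] := block_coord_itv a (Below s).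
move: st; rewrite le_Below /block_coord => /orP[st1|/andP[/eqP -> st2]].
  case: (ltgtP a s.1) => [as1|sa|->]; rewrite ?st1//.
  - by rewrite (lt_trans as1 st1).
  - by have /andP[] := block_coord_itv a (Below t).
  - by rewrite ltW// ico01_lt1.
by case: ltgtP.
Qed.

Lemma block_coord_range (R : realType) a :
  range (@block_coord R a) = `[0, 1]%classic.
Proof.
rewrite eqEsubset; split=> [_ [x _ <-]|c] /=.
  by rewrite in_itv /= block_coord_itv.
rewrite in_itv /= => /andP[c0]; rewrite le_eqVlt => /orP[/eqP ->|c1].
  (* A block omits its right end, so the value 1 is taken at [Top]. *)
  by exists Top.
have c01 : 0 <= c < 1 by rewrite c0.
by exists (Below (a, Ico01 c01)) => //=; rewrite ltxx eqxx.
Qed.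

(** The coordinate of the block of the smaller point separates: it is less than 1 there and equals 1
    at points of later blocks, while inside the block it is the position itself. *)
Lemma block_coord_inj (R : realType) (x y : add_top (long_ray R)) :
  (forall a, block_coord a x = block_coord a y) -> x = y.
Proof.
wlog xy : x y / (x <= y)%O.
  move=> W xy; have /orP[/W|/W ->//] := le_total x y; first exact.
case: x y xy => [s|] [t|] //= st; last first.
  move=> /(_ s.1); rewrite /= ltxx eqxx => s1.
  by have := ico01_lt1 s.2; rewrite s1 ltxx.
move: st; rewrite le_Below => /orP[st1|/andP[/eqP st1 _]] /(_ s.1).
  by rewrite ltxx eqxx st1 => s1; have := ico01_lt1 s.2; rewrite s1 ltxx.
rewrite -st1 ltxx eqxx => /val_inj st2.
by move: s t st1 st2 => [? ?] [? ?] /= -> ->.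
Qed.

(** The support lies in the blocks up to and including that of [x], and initial segments of [omega1]
    are countable. *)
Lemma block_coord_countable (R : realType) (x : add_top (long_ray R)) :
  x <> Top -> countable [set a | block_coord a x != 0].
Proof.
case: x => [t _|//].
apply: (@sub_countable _ _ _ ([set a | (a < t.1)%O] `|` [set t.1])).
  apply: subset_card_le => a /=.
  by case: ltgtP => [|//|->]; [left|rewrite eqxx|right].
rewrite -bigcup2E; apply: bigcup_countable => // -[|[|i]] _ //=.
  exact: omega1_segment_countable.
Qed.

(** * Limits and suprema in the long ray with a top *)

(** A greatest index would make [omega1] a countable initial segment plus one point. *)
Lemma omega1_unbounded (a : omega1) : exists b, (a < b)%O.
Proof.
apply: contrapT => na; apply: omega1_uncountable.
apply: (@sub_countable _ _ _ ([set b | (b < a)%O] `|` [set a])); last first.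
  rewrite -bigcup2E; apply: bigcup_countable => // -[|[|i]] _ //=.
  exact: omega1_segment_countable.
apply: subset_card_le => b _ /=.
by case: (ltgtP b a) => [|ab|->]; [left|case: na; exists b|right].
Qed.

Lemma long_ray_top_limit (R : realType) (x : add_top (long_ray R)) :
  (x < Top)%O -> exists2 y, (x < y)%O & (y < Top)%O.
Proof.
case: x => [[a s] _|]; last by rewrite ltxx.
have [b ab] := omega1_unbounded a.
exists (Below (b, s)); last by [].
rewrite lt_neqAle; apply/andP; split.
  by apply/eqP => -[ab']; move: ab; rewrite ab' ltxx.
by rewrite le_Below /= ab.
Qed.

(** Well-foundedness gives the first block [a] containing an upper bound. The supremum lies in it,
    at the real supremum of the positions that [A] takes there, or at 0 if it takes none. Without
    such a block the supremum is [Top]. *)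
Lemma long_ray_complete (R : realType) (A : set (add_top (long_ray R))) :
  supremums A !=set0.
Proof.
pose U := [set a | exists s, ubound A (Below (a, s) : add_top (long_ray R))].
have [U0|nU] := pselect (U !=set0); last first.
  exists Top; split=> [[]//|[[a s] us|//]].
  by exfalso; apply: nU; exists a, s.
have [a [s as_ub] amin] := omega1_well_founded U0.
have zP : 0 <= (0 : R) < 1 by rewrite lexx ltr01.
pose V := [set ico01_val t | t in [set t : ico01 R | A (Below (a, t))]].
have leb (b : omega1) (t t' : ico01 R) :
    (Below ((b, t) : long_ray R) <= Below ((b, t') : long_ray R))%O =
    (ico01_val t <= ico01_val t').
  by rewrite le_Below /= ltxx eqxx.
have Vs : ubound V (ico01_val s).
  by move=> _ [t At <-]; rewrite -(leb a); exact: as_ub.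
have subA x : A x -> exists b t, x = Below (b, t) /\ ((b < a)%O \/ b = a).
  move=> Ax; case: x Ax (as_ub _ Ax) => [[b t]|//] _.
  rewrite le_Below /= => bta; exists b, t; split=> //.
  by case/orP: bta => [|/andP[/eqP]]; [left|right].
have [V0|nV] := pselect (V !=set0).
  have Vsup : has_sup V by split=> //; exists (ico01_val s).
  have mP : 0 <= sup V < 1.
    apply/andP; split.
      case: V0 => _ [t At _]; apply: (le_trans (ico01_ge0 t)).
      by apply: ub_le_sup; [case: Vsup|exists t].
    (* The bound [s] is itself a position in [[0, 1)], which keeps [sup V] inside the block. *)
    by apply: le_lt_trans (ico01_lt1 s); apply: ge_sup.
  exists (Below (a, Ico01 mP)); split.
    move=> x Ax; have [b [t [xE [ba|ba]]]] := subA _ Ax; rewrite {}xE in Ax *.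
      by rewrite le_Below /= ba.
    rewrite ba leb/=; apply: ub_le_sup; first by case: Vsup.
    by exists t => //=; rewrite -ba.
  move=> [[b t] ubt|//].
  rewrite le_Below /=.
  have : (a <= b)%O by apply: amin; exists t.
  rewrite le_eqVlt => /orP[/eqP ab|->//]; rewrite ab eqxx ltxx/=.
  by apply: ge_sup => // _ [u Au <-]; rewrite -(leb a) {2}ab; exact: ubt.
(* Here [A] stops before block [a], and by minimality of [a] no upper bound lies before the left end
   of that block. *)
exists (Below (a, Ico01 zP)); split.
  move=> x Ax; have [b [t [xE [ba|ba]]]] := subA _ Ax; rewrite {}xE in Ax *.
    by rewrite le_Below /= ba.
  by exfalso; apply: nV; exists (ico01_val t), t => //=; rewrite -ba.
move=> [[b t] ubt|//].
rewrite le_Below /= ico01_ge0 andbT.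
by rewrite orbC -le_eqVlt; apply: amin; exists t.
Qed.

(** * Transfer along monotone maps, density and gluing *)

(** Block coordinates of the maps [r i] are monotone onto [[0, 1]], hence continuous. One map serves
    the long ray with a top and two serve the long interval; countability of [I] keeps the union of
    the supports countable. *)
Lemma valdivia_long_ray_maps (R : realType) d (L : orderType d) (I : countType)
    (r : I -> L -> add_top (long_ray R)) :
  (forall A : set L, supremums A !=set0) ->
  (forall i, {homo r i : x y / (x <= y)%O} \/
             {homo r i : x y / (x <= y)%O >-> (y <= x)%O}) ->
  (forall i, range (r i) = setT) ->
  (forall x y, (forall i, r i x = r i y) -> x = y) ->
  @dense (order_topology L) [set x | forall i, r i x <> Top] ->
  valdivia_compact R (order_topology L).
Proof.
move=> supL rmono rsurj rinj rdense.
pose f (x : order_topology L) : {ptws (I * omega1)%type -> R} :=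
  fun k => block_coord k.2 (r k.1 x).
have itv01 : is_interval (`[0, 1]%classic : set R).
  exact: interval_is_interval.
apply: (@valdivia_dense R (order_topology L) _ f).
- exact: complete_order_compact.
- move=> x y fxy; apply: rinj => i; apply: block_coord_inj => a.
  exact: (congr1 (fun g : {ptws _ -> _} => g (i, a)) fxy).
- move=> [i a] /=.
  have rcr : range (fun x => block_coord a (r i x)) = `[0, 1]%classic.
    by rewrite -(block_coord_range R a) -(rsurj i) -image_comp.
  have [ri|ri] := rmono i.
    apply: nondecreasing_itv_continuous; last by rewrite rcr.
    by move=> x y /ri; exact: block_coord_homo.
  apply: nonincreasing_itv_continuous; last by rewrite rcr.
  by move=> x y /ri; exact: block_coord_homo.
- by move=> x k; exact: block_coord_itv.
move=> U U0 Uo; have [x [Ux rx]] := rdense U U0 Uo; exists x; split=> //=.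
rewrite (_ : [set k | _] =
  \bigcup_i (pair i @` [set a | block_coord a (r i x) != 0])); last first.
  rewrite predeqE => -[i a]; split=> /= [ia|[j _ [b jb [<- <-]]]//].
  by exists i => //; exists a.
apply: bigcup_countable => // i _.
exact: sub_countable (card_image_le _ _) (block_coord_countable (rx i)).
Qed.

Lemma omega1_nonempty : inhabited omega1.
Proof.
apply: contrapT => no; apply: omega1_uncountable.
by rewrite (_ : [set: omega1] = set0) // predeqE => a; split=> // _; apply: no.
Qed.

(** A basic neighbourhood of a one-sided limit of [D] contains an open interval ending at that
    point, hence a point of [D]. The assumed point on that side provides the other end when the
    neighbourhood is unbounded there. *)
Lemma dense_order_limits d (T : orderTopologicalType d) (D : set T) :
  (forall x, D x \/
    ((exists u, (u < x)%O) /\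
      forall u, (u < x)%O -> exists2 v, D v & (u < v < x)%O) \/
    ((exists u, (x < u)%O) /\
      forall u, (x < u)%O -> exists2 v, D v & (x < v < u)%O)) ->
  dense D.
Proof.
move=> lim U [x Ux] Uo; have : nbhs x U by apply: open_nbhs_nbhs.
rewrite itv_nbhsE => -[i [io xi] iU].
suff [v Dv vi] : exists2 v, D v & v \in i by exists v; split=> //; exact: iU.
have [Dx|[|]] := lim x; first by exists x.
  move=> [[u0 u0x] below].
  have [u ux ui] : exists2 u, (u < x)%O & forall v, (u < v < x)%O -> v \in i.
    case: i xi io {iU} => [[[] l|[]] [[] r|[]]];
      rewrite /itv_open_ends //= in_itv/=.
    - move=> /andP[lx xr] _; exists l => // v /andP[lv vx].
      by rewrite in_itv/= lv (lt_trans vx xr).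
    - rewrite andbT => lx _; exists l => // v /andP[lv _].
      by rewrite in_itv/= lv.
    - move=> xr _; exists u0 => // v /andP[_ vx].
      by rewrite in_itv/= (lt_trans vx xr).
    - by move=> _ _; exists u0.
  by have [v Dv uvx] := below _ ux; exists v => //; exact: ui.
move=> [[u0 xu0] above].
have [u xu ui] : exists2 u, (x < u)%O & forall v, (x < v < u)%O -> v \in i.
  case: i xi io {iU} => [[[] l|[]] [[] r|[]]];
    rewrite /itv_open_ends //= in_itv/=.
  - move=> /andP[lx xr] _; exists r => // v /andP[xv vr].
    by rewrite in_itv/= vr (lt_trans lx xv).
  - rewrite andbT => lx _; exists u0 => // v /andP[xv _].
    by rewrite in_itv/= (lt_trans lx xv).
  - move=> xr _; exists r => // v /andP[_ vr].
    by rewrite in_itv/= vr.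
  - by move=> _ _; exists u0.
by have [v Dv xvu] := above _ xu; exists v => //; exact: ui.
Qed.

(** If [A] meets the upper half, its supremum is computed there through [phi]; otherwise [A] lies
    below [p] and the reversed copy [psi] is used. *)
Lemma glued_complete d d' (L : orderType d) (M : orderType d') (p : L)
    (phi psi : L -> M) :
  (forall A : set M, supremums A !=set0) ->
  (forall m, exists2 x, (p <= x)%O & phi x = m) ->
  (forall m, exists2 x, (x <= p)%O & psi x = m) ->
  (forall x y, (p <= x)%O -> (p <= y)%O -> (phi x <= phi y)%O = (x <= y)%O) ->
  (forall x y, (x <= p)%O -> (y <= p)%O -> (psi x <= psi y)%O = (y <= x)%O) ->
  forall A : set L, supremums A !=set0.
Proof.
move=> supM phis psis phim psim A.
have [[a [Aa pa]]|nA] := pselect (exists a, A a /\ (p <= a)%O).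
  have [m [ubm lubm]] := supM (phi @` (A `&` [set x | (p <= x)%O])).
  have [s ps sm] := phis m; exists s; split.
    move=> x Ax; have [px|xp] := leP p x; last exact: le_trans (ltW xp) ps.
    by rewrite -phim// sm; apply: ubm; exists x.
  move=> u uA; have pu : (p <= u)%O := le_trans pa (uA _ Aa).
  rewrite -phim// sm; apply: lubm => _ [x [Ax px] <-].
  by rewrite phim//; exact: uA.
have Ap x : A x -> (x <= p)%O.
  by move=> Ax; rewrite leNgt; apply/negP => /ltW px; apply: nA; exists x.
(* As [psi] reverses the order, this supremum in [M] corresponds to the infimum of the upper bounds
   of [A] below [p], which is the supremum of [A]. *)
have [m [ubm lubm]] := supM (psi @` (ubound A `&` [set x | (x <= p)%O])).
have [s sp sm] := psis m; exists s; split.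
  move=> x Ax; have xp := Ap _ Ax.
  rewrite -psim// sm; apply: lubm => _ [u [uA up] <-].
  by rewrite psim//; exact: uA.
move=> u uA; have [up|pu] := leP u p; last exact: le_trans sp (ltW pu).
by rewrite -psim// sm; apply: ubm; exists u.
Qed.

(** * The two spaces *)

Theorem proposition5p1 (R : realType) :
  valdivia_compact R (order_topology (add_top (long_ray R))) /\
  forall (d : Order.disp_t) (L : tbOrderType d),
    is_long_interval R L -> valdivia_compact R (order_topology L).
Proof.
have lt_Top (x : add_top (long_ray R)) : x <> Top -> (x < Top)%O.
  by move=> /eqP xT; rewrite lt_neqAle xT; case: x {xT}.
split.
  apply: (@valdivia_long_ray_maps R _ _ unit (fun=> id)).
  - exact: long_ray_complete.
  - by left.
  - by move=> _; rewrite predeqE => x; split=> // _; exists x.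
  - by move=> x y; apply; exact: tt.
  apply: dense_order_limits => x.
  have [->|xT] := pselect (x = Top); last by left.
  right; left; split.
    have [a] := omega1_nonempty.
    by exists (Below (a, Ico01 (introT andP (conj (lexx 0) ltr01)))).
  move=> u /long_ray_top_limit[v uv vT]; exists v; last by rewrite uv.
  by move=> _ vE; move: vT; rewrite vE ltxx.
move=> d L [[p /andP[bp pt]]] /(_ p); rewrite bp pt => /(_ isT).
move=> [[phi [phib phim0]] [psi [psib psim0]]].
have phis m : exists2 x, (p <= x)%O & phi x = m.
  have [_ _ /(_ m I)[x /=]] := phib; rewrite in_itv/= => /andP[px _] xm.
  by exists x.
have psis m : exists2 x, (x <= p)%O & psi x = m.
  have [_ _ /(_ m I)[x /=]] := psib; rewrite in_itv/= => /andP[_ px] xm.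
  by exists x.
have phim x y : (p <= x)%O -> (p <= y)%O -> (phi x <= phi y)%O = (x <= y)%O.
  by move=> px py; apply: phim0; rewrite /= in_itv/= lex1 ?px ?py.
(* [psim0] speaks of the dual order; read in the order itself, [psi] is decreasing. *)
have psim x y : (x <= p)%O -> (y <= p)%O ->
    (psi x <= psi y :> add_top (long_ray R))%O = (y <= x)%O.
  by move=> px py; apply: (psim0 y x); rewrite /= in_itv/= le0x ?px ?py.
have phiT x : (p <= x)%O -> phi x = Top -> x = \top%O.
  move=> px xT; apply/eqP; rewrite -le1x -phim ?lex1// xT.
  by case: (phi _).
have psiT x : (x <= p)%O -> psi x = Top -> x = \bot%O.
  move=> px xT; apply/eqP; rewrite -lex0 -psim ?le0x// xT.
  by case: (psi _).
have pmax x : (p <= Order.max x p)%O by rewrite le_max lexx orbT.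
have minp x : (Order.min x p <= p)%O by rewrite ge_min lexx orbT.
pose r (b : bool) x := if b then phi (Order.max x p) else psi (Order.min x p).
(* [Top] is reached by [r true] only at the greatest element of [L] and by [r false] only at the
   least, so every interior point has countable support. *)
have phiN x : (x < \top)%O -> r true x <> Top.
  move=> xt rT; have : (Order.max x p < \top)%O by rewrite gt_max xt pt.
  by rewrite [Order.max x p]phiT ?ltxx.
have psiN x : (\bot < x)%O -> r false x <> Top.
  move=> bx rT; have : (\bot < Order.min x p)%O by rewrite lt_min bx bp.
  by rewrite [Order.min x p]psiT ?ltxx.
have Dr x : (\bot < x < \top)%O -> forall b, r b x <> Top.
  by move=> /andP[bx xt] []; [exact: phiN|exact: psiN].
apply: (@valdivia_long_ray_maps R _ _ bool r).
- exact: glued_complete (@long_ray_complete R) phis psis phim psim.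
- case; [left|right] => x y xy.
    by rewrite /r phim// ge_max !le_max xy lexx !orbT.
  by rewrite /r psim// le_min !ge_min xy lexx !orbT.
- case; rewrite predeqE => m; split=> // _.
    by have [x px <-] := phis m; exists x; rewrite // /r max_l.
  by have [x xp <-] := psis m; exists x; rewrite // /r min_l.
- move=> x y rxy.
  have /eqP := rxy true; have /eqP := rxy false; rewrite /r.
  rewrite !eq_le !psim// !phim// andbC -!eq_le => /eqP mn /eqP mx.
  (* The points agree after both [max] and [min] with [p]. On opposite sides of [p], the lower one
     would have to equal [p]. *)
  have [px|xp] := leP p x; have [py|yp] := leP p y.
  + by rewrite -(max_l px) mx max_l.
  + have yE : y = p by rewrite -(min_l (ltW yp)) -mn min_r.
    by rewrite yE ltxx in yp.
  + have xE : x = p by rewrite -(min_l (ltW xp)) mn min_r.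
    by rewrite xE ltxx in xp.
  + by rewrite -(min_l (ltW xp)) mn min_l// ltW.
apply: dense_order_limits => x.
have [->|xb] := eqVneq x \bot%O.
  right; right; split; first by exists p.
  (* A value strictly between [psi (Order.min u p)] and [Top] pulls back to a point [v] strictly
     between the least element and [u]; [v] is not the least element, since [psi] sends that to
     [Top]. *)
  move=> u /psiN/lt_Top/long_ray_top_limit[m]; have [v vp <-] := psis m.
  rewrite !ltNge psim// -!ltNge lt_min => /andP[vu _] vT.
  have bv : (\bot < v)%O.
    rewrite lt0x; apply: contraTneq vT => ->.
    by have [b bp' <-] := psis Top; rewrite -leNgt psim// ltW.
  by exists v; [apply: Dr; rewrite bv (le_lt_trans vp)|rewrite bv].
have [->|xt] := eqVneq x \top%O.
  right; left; split; first by exists p.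
  (* The mirror argument at the greatest element, through [phi]. *)
  move=> u /phiN/lt_Top/long_ray_top_limit[m]; have [v pv <-] := phis m.
  rewrite !ltNge phim// -!ltNge gt_max => /andP[uv _] vT.
  have vt : (v < \top)%O.
    rewrite ltx1; apply: contraTneq vT => ->.
    by have [b pb <-] := phis Top; rewrite -leNgt phim// ltW.
  by exists v; [apply: Dr; rewrite vt (lt_le_trans bp)|rewrite uv].
by left; apply: Dr; rewrite lt0x ltx1 xb.
Qed.
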